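(* For complex $a$ with $\operatorname{Re}(a)>0$, any complex $b$ and all complex $z$, $$a z\,\frac{d}{dz}E_{a,b}(z)=E_{a,b-1}(z)-(b-1)E_{a,b}(z).$$
   Context: The Mittag-Leffler function is $E_{a,b}(z)=\sum_{k=0}^{\infty}\frac{z^{k}}{\Gamma(b+ak)}$, where $1/\Gamma$ is the entire reciprocal Gamma function; for $\operatorname{Re}(a)>0$ and any complex $b$ it is an entire function of $z$. *)

(* Defs.v *)
From Stdlib Require Import Reals Factorial.
From Coquelicot Require Import Coquelicot.

Open Scope C_scope.

(* Limits and sums of complex sequences are taken componentwise, which agrees
   with the limit in C whenever the latter exists; like [Lim_seq] and [Series],
   they are total and carry no information for divergent sequences. *)
Definition C_Lim_seq (u : nat -> C) : C :=
  (real (Lim_seq (fun n => Re (u n))), real (Lim_seq (fun n => Im (u n)))).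

Definition C_Series (u : nat -> C) : C :=
  (Series (fun n => Re (u n)), Series (fun n => Im (u n))).

Definition Cexp (z : C) : C :=
  ((exp (Re z) * cos (Im z))%R, (exp (Re z) * sin (Im z))%R).

(* s (s + 1) ... (s + n - 1), with n factors *)
Fixpoint Crising (s : C) (n : nat) : C :=
  match n with
  | O => 1
  | S m => Crising s m * (s + RtoC (INR m))
  end.

(* The entire function 1/Gamma, by the Euler-Gauss limit, valid for all s in C:
     1/Gamma(s) = lim_n  s (s + 1) ... (s + n) / (n! n^s),
   with n^s = exp (s ln n).  It vanishes at s = 0, -1, -2, etc. *)
Definition rGamma (s : C) : C :=
  C_Lim_seq (fun n =>
    Crising s (S n) /
      (RtoC (INR (fact n)) * Cexp (s * RtoC (ln (INR n))))).

(* Each term is z^k times the value of the entire function 1/Gamma, so no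
   division by Gamma at a pole is involved. *)
Definition MittagLeffler (a b z : C) : C :=
  C_Series (fun k => z ^ k * rGamma (b + a * RtoC (INR k))).

(* Main.v *)
Require Import Defs.
From Stdlib Require Import Reals Lra Lia Factorial.
From Coquelicot Require Import Coquelicot.

(** Write c_k = 1/Gamma(b + a k), so that E_{a,b}(z) is the sum of c_k z^k.  The
    functional equation s / Gamma(s + 1) = 1/Gamma(s) at s = b - 1 + a k says
    (b - 1 + a k) c_k = 1/Gamma(b - 1 + a k); multiplied by z^k and summed, with
    the term a k z^k c_k recognised as a z times the k-th term of the derivative,
    it is the identity to prove.  What has to be established is that 1/Gamma is
    given by a convergent limit satisfying this equation ([is_lim_euler_prod],
    [rGamma_shift]), and that the c_k decay faster than every geometric sequence
    ([entire_coeffs_rGamma]), so that the series may be differentiated term by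
    term in the complex sense ([is_derive_C_PSeries]).

    Convergence and decay come from one estimate.  Consecutive Euler products
    A_n(s) = s (s + 1) ... (s + n) / (n! n^s) differ by the factor
    (1 + s/(n + 1)) exp (- s ln ((n + 1)/n)), whose first-order terms cancel:
    for 2|s| <= m <= n it is 1 + O(m^2 / n^2) with an absolute constant
    ([euler_factor_bound]).  Hence the products converge, and
    |1/Gamma(s)| <= |A_m(s)| e^{O(m)}.  Bounding A_m(s) by hand gives
    |1/Gamma(s)| <= exp (16 m - Re s ln m) for every integer m >= 1 with
    m >= 2|s| ([rGamma_bound]), a weak form of Stirling's formula.  At
    s = b + a k take m proportional to k + 1: the exponent is
    O(k) - (Re b + k Re a) ln m, and since Re a > 0 the term k ln k wins over
    every multiple of k. *)

Local Open Scope R_scope.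

(** * The complex exponential near 0 *)

Lemma Cmod_le_Re_Im (z : C) : Cmod z <= Rabs (Re z) + Rabs (Im z).
Proof.
  replace z with (RtoC (Re z) + (0, Im z))%C at 1
    by (destruct z; unfold RtoC, Cplus, Re, Im; simpl; f_equal; ring).
  eapply Rle_trans; [apply Cmod_triangle|].
  rewrite Cmod_R. apply Rplus_le_compat_l.
  right. unfold Cmod; simpl.
  rewrite <- sqrt_Rsqr_abs. f_equal. unfold Rsqr; ring.
Qed.

Lemma im_le_Cmod (z : C) : Rabs (Im z) <= Cmod z.
Proof. eapply Rle_trans; [apply Rmax_r | apply Rmax_Cmod]. Qed.

Lemma exp_le (x y : R) : x <= y -> exp x <= exp y.
Proof.
  intros [H| ->]; [apply Rlt_le, exp_increasing, H | apply Rle_refl].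
Qed.

(** The upper bound is the lower bound 1 - x <= exp (- x) inverted. *)
Lemma exp_1_taylor2 (x : R) : Rabs x <= 1/2 -> Rabs (exp x - 1 - x) <= 2 * x ^ 2.
Proof.
  intros H. apply Rabs_le_between in H.
  pose proof (exp_ineq1_le x). pose proof (exp_ineq1_le (- x)).
  assert (exp x * exp (- x) = 1) by (rewrite <- exp_plus, Rplus_opp_r; apply exp_0).
  pose proof (exp_pos x).
  assert (exp x * (1 - x) <= 1) by nra.
  assert (exp x <= 1 + x + 2 * x ^ 2).
  { apply Rmult_le_reg_r with (1 - x); [lra|]. nra. }
  rewrite Rabs_pos_eq; lra.
Qed.

Lemma sin_taylor2 (y : R) : Rabs y <= 1/2 -> Rabs (sin y - y) <= y ^ 2.
Proof.
  assert (pos : forall t, 0 <= t <= 1/2 -> Rabs (sin t - t) <= t ^ 2).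
  { intros t Ht. pose proof PI2_1.
    destruct (sin_bound t 0) as [H1 _]; [lra|lra|].
    change (sin_approx t (2 * 0 + 1)) with
      (1 * (t ^ 1 / 1) + (-1 * 1) * (t ^ 3 / INR (fact 3))) in H1.
    replace (INR (fact 3)) with 6 in * by (simpl; ring).
    assert (sin t <= t) by (pose proof (sin_lt_x t); destruct (Req_dec t 0);
      [subst; rewrite sin_0|]; lra).
    assert (0 <= t ^ 2) by apply pow2_ge_0.
    rewrite Rabs_left1 by lra.
    replace (t ^ 3) with (t * t ^ 2) in H1 by ring. nra. }
  intros H. destruct (Rle_dec 0 y) as [Hy|Hy].
  - apply pos. rewrite Rabs_pos_eq in H; lra.
  - rewrite Rabs_left1 in H by lra.
    specialize (pos (- y) ltac:(lra)).
    rewrite sin_neg in pos.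
    rewrite <- Rabs_Ropp.
    replace (- (sin y - y)) with (- sin y - - y) by ring.
    replace (y ^ 2) with ((- y) ^ 2) by ring. exact pos.
Qed.

(** From 1 - cos y <= (1 - cos y) (1 + cos y) = sin^2 y where cos y >= 0. *)
Lemma cos_taylor2 (y : R) : Rabs y <= 1/2 -> Rabs (cos y - 1) <= 3 * y ^ 2.
Proof.
  intros H.
  pose proof (sin2_cos2 y) as E; unfold Rsqr in E.
  pose proof (COS_bound y).
  pose proof (sin_taylor2 y H) as Hs.
  assert (Hsin : Rabs (sin y) <= 3/2 * Rabs y).
  { replace (sin y) with ((sin y - y) + y) by ring.
    eapply Rle_trans; [apply Rabs_triang|].
    rewrite <- (pow2_abs y) in Hs. pose proof (Rabs_pos y). nra. }
  assert (0 <= cos y).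
  { apply Rabs_le_between in H. pose proof PI2_1. apply cos_ge_0; lra. }
  assert (sin y ^ 2 <= (3/2 * Rabs y) ^ 2).
  { rewrite <- (pow2_abs (sin y)). apply pow_incr. split; [apply Rabs_pos|lra]. }
  rewrite Rpow_mult_distr, pow2_abs in *.
  rewrite Rabs_left1 by lra. nra.
Qed.

Lemma Cexp_taylor2 (w : C) :
  Cmod w <= 1/2 -> Cmod (Cexp w - 1 - w)%C <= 14 * Cmod w ^ 2.
Proof.
  intros Hw.
  pose proof (re_le_Cmod w) as Hx. pose proof (im_le_Cmod w) as Hy.
  pose proof (Cmod2_alt w) as HE.
  eapply Rle_trans; [apply Cmod_le_Re_Im|].
  destruct w as [x y]; unfold Re, Im, Cexp in *; simpl fst in *; simpl snd in *.
  rewrite HE.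
  pose proof (exp_1_taylor2 x ltac:(lra)) as H1.
  pose proof (sin_taylor2 y ltac:(lra)) as H2.
  pose proof (cos_taylor2 y ltac:(lra)) as H3.
  assert (He : 0 < exp x <= 2).
  { split; [apply exp_pos|].
    assert (Hx2 : Rabs x <= 1/2) by lra. apply Rabs_le_between in Hx2.
    apply Rabs_le_between in H1. nra. }
  assert (He1 : Rabs (exp x - 1) <= 2 * Rabs x).
  { replace (exp x - 1) with ((exp x - 1 - x) + x) by ring.
    eapply Rle_trans; [apply Rabs_triang|].
    rewrite <- (pow2_abs x) in H1. pose proof (Rabs_pos x). nra. }
  replace (exp x * cos y + - (1) + - x)
    with ((exp x - 1 - x) + exp x * (cos y - 1)) by ring.
  replace (exp x * sin y + - 0 + - y)
    with (exp x * (sin y - y) + (exp x - 1) * y) by ring.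
  pose proof (Rabs_triang (exp x - 1 - x) (exp x * (cos y - 1))) as T1.
  pose proof (Rabs_triang (exp x * (sin y - y)) ((exp x - 1) * y)) as T2.
  rewrite (Rabs_mult (exp x)) in T1.
  rewrite (Rabs_mult (exp x)), (Rabs_mult (exp x - 1)) in T2.
  rewrite (Rabs_pos_eq (exp x)) in T1, T2 by lra.
  pose proof (Rabs_pos y). pose proof (Rabs_pos x).
  pose proof (Rabs_pos (cos y - 1)). pose proof (Rabs_pos (sin y - y)).
  rewrite <- (pow2_abs x), <- (pow2_abs y) in *.
  assert (exp x * Rabs (cos y - 1) <= 2 * (3 * Rabs y ^ 2)) by (apply Rmult_le_compat; lra).
  assert (exp x * Rabs (sin y - y) <= 2 * (Rabs y ^ 2)) by (apply Rmult_le_compat; lra).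
  assert (Rabs (exp x - 1) * Rabs y <= 2 * Rabs x * Rabs y)
    by (apply Rmult_le_compat_r; lra).
  pose proof (pow2_ge_0 (Rabs x - Rabs y)). nra.
Qed.

Lemma Cexp_plus (z w : C) : Cexp (z + w)%C = (Cexp z * Cexp w)%C.
Proof.
  destruct z as [x y], w as [u v]; unfold Cexp, Cmult, Cplus, Re, Im; simpl.
  rewrite exp_plus, cos_plus, sin_plus. f_equal; ring.
Qed.

Lemma Cmod_Cexp (z : C) : Cmod (Cexp z) = exp (Re z).
Proof.
  unfold Cmod, Cexp; simpl.
  pose proof (sin2_cos2 (Im z)) as E; unfold Rsqr in E.
  replace (_ + _) with (Rsqr (exp (Re z)))
    by (unfold Rsqr; transitivity (exp (Re z) * exp (Re z) *
       (sin (Im z) * sin (Im z) + cos (Im z) * cos (Im z)));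
       [rewrite E; ring | ring]).
  apply sqrt_Rsqr, Rlt_le, exp_pos.
Qed.

Lemma Cexp_neq_0 (z : C) : Cexp z <> 0%C.
Proof. apply Cmod_gt_0. rewrite Cmod_Cexp. apply exp_pos. Qed.

Lemma Cexp_0 : Cexp 0%C = 1%C.
Proof.
  unfold Cexp, Re, Im; simpl. rewrite exp_0, cos_0, sin_0.
  unfold RtoC. f_equal; ring.
Qed.

Lemma Cexp_RtoC (x : R) : Cexp (RtoC x) = RtoC (exp x).
Proof.
  unfold Cexp, RtoC, Re, Im; simpl. rewrite cos_0, sin_0. f_equal; ring.
Qed.

(** * Euler's products *)

(** The n-th term of the limit that defines 1/Gamma. *)
Definition euler_prod (s : C) (n : nat) : C :=
  (Crising s (S n) / (RtoC (INR (fact n)) * Cexp (s * RtoC (ln (INR n)))))%C.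

(** Both bounds are 1 + x <= exp x, at x = - 1/(n + 1) and at x = 1/n. *)
Lemma ln_succ_bounds (n : nat) : (1 <= n)%nat ->
  / INR (S n) <= ln (INR (S n)) - ln (INR n) <= / INR n.
Proof.
  intros Hn. assert (0 < INR n) by (apply lt_0_INR; lia).
  assert (0 < INR (S n)) by (apply lt_0_INR; lia).
  rewrite <- ln_div by assumption.
  split.
  - rewrite <- (Ropp_involutive (ln _)), <- ln_Rinv by (apply Rdiv_lt_0_compat; assumption).
    replace (/ (INR (S n) / INR n)) with (1 + - / INR (S n))
      by (rewrite S_INR in *; field; lra).
    rewrite <- (Ropp_involutive (/ INR (S n))) at 1.
    apply Ropp_le_contravar.
    rewrite <- (ln_exp (- / INR (S n))) at 2.
    apply ln_le; [|apply exp_ineq1_le].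
    rewrite S_INR in *. replace (1 + - / (INR n + 1)) with (INR n / (INR n + 1)) by (field; lra).
    apply Rdiv_lt_0_compat; assumption.
  - replace (INR (S n) / INR n) with (1 + / INR n) by (rewrite S_INR; field; lra).
    rewrite <- (ln_exp (/ INR n)) at 2.
    apply ln_le; [|apply exp_ineq1_le].
    assert (0 < / INR n) by (apply Rinv_0_lt_compat; assumption). lra.
Qed.

Lemma euler_prod_S (s : C) (n : nat) : (1 <= n)%nat ->
  euler_prod s (S n) =
  (euler_prod s n * ((1 + s / RtoC (INR (S n))) *
     Cexp (- (s * RtoC (ln (INR (S n)) - ln (INR n))))))%C.
Proof.
  intros Hn. unfold euler_prod.
  assert (E : Cexp (s * RtoC (ln (INR (S n))))%C =
    (Cexp (s * RtoC (ln (INR n))) * Cexp (s * RtoC (ln (INR (S n)) - ln (INR n))))%C).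
  { rewrite <- Cexp_plus. f_equal. rewrite RtoC_minus. ring. }
  rewrite E. clear E.
  assert (E : (Cexp (s * RtoC (ln (INR (S n)) - ln (INR n)))
    * Cexp (- (s * RtoC (ln (INR (S n)) - ln (INR n)))) = 1)%C).
  { rewrite <- Cexp_plus, Cplus_opp_r. apply Cexp_0. }
  pose proof (Cexp_neq_0 (s * RtoC (ln (INR n)))%C) as N1.
  pose proof (Cexp_neq_0 (s * RtoC (ln (INR (S n)) - ln (INR n)))%C) as N2.
  set (a := Cexp (s * RtoC (ln (INR n)))%C) in *.
  set (b := Cexp (s * RtoC (ln (INR (S n)) - ln (INR n)))%C) in *.
  set (c := Cexp (- (s * RtoC (ln (INR (S n)) - ln (INR n))))%C) in *.
  replace c with (/ b)%C
    by (rewrite <- (Cmult_1_r (/ b)), <- E, Cmult_assoc, Cinv_l by assumption; ring).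
  assert (N3 : RtoC (INR (fact n)) <> 0%C)
    by (intro H; apply RtoC_inj in H; revert H; apply INR_fact_neq_0).
  assert (N4 : RtoC (INR (S n)) <> 0%C)
    by (intro H; apply RtoC_inj in H; revert H; apply not_0_INR; lia).
  change (fact (S n)) with (S n * fact n)%nat.
  rewrite mult_INR, RtoC_mult.
  change (Crising s (S (S n))) with (Crising s (S n) * (s + RtoC (INR (S n))))%C.
  field. repeat split; assumption.
Qed.

(** Replaces the summable 1/n^2 by a telescoping quantity. *)
Lemma inv_diff (n : nat) : (1 <= n)%nat ->
  / INR n ^ 2 <= 2 * (/ INR n - / INR (S n)).
Proof.
  intros Hn. assert (1 <= INR n) by (apply (le_INR 1); lia).
  rewrite S_INR.
  apply Rmult_le_reg_r with (INR n ^ 2 * (INR n + 1)); [nra|].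
  field_simplify; nra.
Qed.

(** With w = - s ln ((n + 1)/n) and t = s/(n + 1), the factor minus 1 is
    (e^w - 1 - w) + (w + t) + t (e^w - 1).  Each summand is O(m^2 / n^2): the
    first and third are quadratic in |s|/n, and w + t is at most
    |s| (1/n - 1/(n + 1)) because the logarithm lies between 1/(n + 1) and 1/n. *)
Lemma euler_factor_bound (s : C) (m n : nat) :
  (1 <= m <= n)%nat -> 2 * Cmod s <= INR m ->
  Cmod ((1 + s / RtoC (INR (S n))) *
     Cexp (- (s * RtoC (ln (INR (S n)) - ln (INR n)))) - 1)%C
  <= 12 * INR m ^ 2 * (/ INR n - / INR (S n)).
Proof.
  intros [Hm Hmn] Hs.
  assert (Hm1 : 1 <= INR m) by (apply (le_INR 1); lia).
  assert (Hn1 : INR m <= INR n) by (apply le_INR; lia).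
  pose proof (ln_succ_bounds n ltac:(lia)) as HL.
  pose proof (inv_diff n ltac:(lia)) as Hd.
  set (L := ln (INR (S n)) - ln (INR n)) in *.
  set (p := / INR n) in *. set (q := / INR (S n)) in *.
  assert (Hq : 0 < q) by (apply Rinv_0_lt_compat, lt_0_INR; lia).
  assert (Hp : 0 < p <= 1).
  { split; [apply Rinv_0_lt_compat; lra|].
    unfold p. rewrite <- Rinv_1. apply Rinv_le_contravar; lra. }
  assert (Hmp : INR m * p <= 1).
  { apply Rmult_le_reg_r with (INR n); [lra|]. unfold p.
    rewrite Rmult_assoc, Rinv_l by lra. lra. }
  assert (Hpq : p - q <= p ^ 2).
  { unfold p, q. rewrite S_INR.
    apply Rmult_le_reg_r with (INR n ^ 2 * (INR n + 1)); [nra|].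
    field_simplify; nra. }
  replace (/ INR n ^ 2) with (p ^ 2) in Hd by (unfold p; field; lra).
  set (w := (- (s * RtoC L))%C).
  set (t := (s * RtoC q)%C).
  replace (s / RtoC (INR (S n)))%C with t
    by (unfold t, q, Cdiv; rewrite RtoC_inv; [reflexivity | apply not_0_INR; lia]).
  pose proof (Cmod_ge_0 s) as Hs0.
  assert (Hw : Cmod w <= Cmod s * p).
  { unfold w. rewrite Cmod_opp, Cmod_mult, Cmod_R, Rabs_pos_eq by lra.
    apply Rmult_le_compat_l; lra. }
  assert (Hw2 : Cmod w <= 1/2) by nra.
  assert (Ht : Cmod t <= Cmod s * p).
  { unfold t. rewrite Cmod_mult, Cmod_R, Rabs_pos_eq by lra.
    apply Rmult_le_compat_l; lra. }
  assert (Hwt : Cmod (w + t)%C <= Cmod s * p ^ 2).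
  { replace (w + t)%C with (s * RtoC (q - L))%C
      by (unfold w, t; rewrite RtoC_minus; ring).
    rewrite Cmod_mult, Cmod_R, Rabs_left1 by lra.
    apply Rmult_le_compat_l; lra. }
  pose proof (Cexp_taylor2 w Hw2) as HT.
  replace ((1 + t) * Cexp w - 1)%C with
    ((Cexp w - 1 - w) + (w + t) + t * ((Cexp w - 1 - w) + w))%C by ring.
  pose proof (Cmod_triangle ((Cexp w - 1 - w) + (w + t))%C (t * ((Cexp w - 1 - w) + w))%C) as T1.
  pose proof (Cmod_triangle (Cexp w - 1 - w)%C (w + t)%C) as T2.
  pose proof (Cmod_triangle (Cexp w - 1 - w)%C w) as T3.
  rewrite Cmod_mult in T1.
  pose proof (Cmod_ge_0 w). pose proof (Cmod_ge_0 t).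
  assert (Hw3 : Cmod w ^ 2 <= (Cmod s * p) ^ 2) by (apply pow_incr; lra).
  assert (Hw4 : Cmod (Cexp w - 1 - w + w)%C <= 8 * (Cmod s * p)) by nra.
  assert (HT2 : Cmod t * Cmod (Cexp w - 1 - w + w)%C <= (Cmod s * p) * (8 * (Cmod s * p)))
    by (apply Rmult_le_compat; try assumption; apply Cmod_ge_0).
  assert (H22 : Cmod s ^ 2 <= (INR m / 2) ^ 2) by (apply pow_incr; lra).
  assert (Hp2 : 0 <= p ^ 2) by apply pow2_ge_0.
  assert (Hs1 : Cmod s <= INR m ^ 2 / 2) by nra.
  (* 22 = 14 + 8, and |s| <= m/2 gives 22 |s|^2 + |s| <= 6 m^2. *)
  assert (22 * (Cmod s * p) ^ 2 + Cmod s * p ^ 2 <= 6 * INR m ^ 2 * p ^ 2).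
  { rewrite Rpow_mult_distr.
    replace (22 * (Cmod s ^ 2 * p ^ 2) + Cmod s * p ^ 2)
      with ((22 * Cmod s ^ 2 + Cmod s) * p ^ 2) by ring.
    apply Rmult_le_compat_r; [assumption|].
    replace ((INR m / 2) ^ 2) with (INR m ^ 2 / 4) in H22 by field. lra. }
  apply Rle_trans with (6 * INR m ^ 2 * p ^ 2); [nra|].
  pose proof (pow2_ge_0 (INR m)). nra.
Qed.

(** Multiply the bounds 1 + x <= exp x on the factors; the exponents telescope. *)
Lemma euler_prod_growth (s : C) (m n : nat) :
  (1 <= m <= n)%nat -> 2 * Cmod s <= INR m ->
  Cmod (euler_prod s n) <=
  Cmod (euler_prod s m) * exp (12 * INR m ^ 2 * (/ INR m - / INR n)).
Proof.
  intros [Hm Hmn] Hs. induction Hmn as [|n Hmn IH].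
  - rewrite Rminus_diag, Rmult_0_r, exp_0. lra.
  - rewrite euler_prod_S, Cmod_mult by lia.
    pose proof (euler_factor_bound s m n ltac:(lia) Hs) as HF.
    set (F := ((1 + _) * _)%C) in *.
    assert (HF2 : Cmod F <= exp (12 * INR m ^ 2 * (/ INR n - / INR (S n)))).
    { eapply Rle_trans; [|apply exp_ineq1_le].
      replace F with (1 + (F - 1))%C by ring.
      eapply Rle_trans; [apply Cmod_triangle|]. rewrite Cmod_1. lra. }
    replace (12 * INR m ^ 2 * (/ INR m - / INR (S n))) with
      (12 * INR m ^ 2 * (/ INR m - / INR n) + 12 * INR m ^ 2 * (/ INR n - / INR (S n)))
      by ring.
    rewrite exp_plus, <- Rmult_assoc.
    apply Rmult_le_compat; auto using Cmod_ge_0.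
Qed.

(** By induction, since (1 + 1/k)^k <= e. *)
Lemma pow_le_fact_exp (m : nat) : INR m ^ m <= INR (fact m) * exp (INR m).
Proof.
  induction m as [|m IH]; [simpl; rewrite exp_0; lra|].
  destruct m as [|m].
  { simpl. pose proof (exp_ineq1_le 1). lra. }
  set (k := S m) in *.
  assert (Hk : 0 < INR k) by (apply lt_0_INR; lia).
  change (fact (S k)) with (S k * fact k)%nat.
  rewrite mult_INR. rewrite <- tech_pow_Rmult, Rmult_assoc.
  apply Rmult_le_compat_l; [apply pos_INR|].
  rewrite S_INR, exp_plus, <- Rmult_assoc.
  replace (INR k + 1) with (INR k * (1 + / INR k)) by (field; lra).
  rewrite Rpow_mult_distr.
  apply Rmult_le_compat; auto.
  - apply pow_le, pos_INR.
  - apply pow_le. assert (0 < / INR k) by (apply Rinv_0_lt_compat; lra). lra.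
  - assert (0 < / INR k) by (apply Rinv_0_lt_compat; lra).
    apply Rle_trans with (exp (/ INR k) ^ k).
    + apply pow_incr. split; [lra|apply exp_ineq1_le].
    + rewrite <- Rpower_pow by apply exp_pos. unfold Rpower. rewrite ln_exp, Rinv_r; lra.
Qed.

(** Each of the n factors s + j, with j < n, has modulus at most |s| + n - 1 <= r. *)
Lemma Crising_bound (s : C) (r : R) (n : nat) :
  Cmod s + INR n <= r + 1 -> Cmod (Crising s n) <= r ^ n.
Proof.
  induction n as [|n IH]; intros H.
  - simpl. rewrite Cmod_1. lra.
  - rewrite S_INR in H. cbn [Crising]. rewrite Cmod_mult, <- tech_pow_Rmult, Rmult_comm.
    apply Rmult_le_compat; auto using Cmod_ge_0.
    + eapply Rle_trans; [apply Cmod_triangle|].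
      rewrite Cmod_R, Rabs_pos_eq by apply pos_INR. lra.
    + apply IH. lra.
Qed.

Lemma Cmod_euler_prod (s : C) (n : nat) :
  Cmod (euler_prod s n) =
  Cmod (Crising s (S n)) / INR (fact n) * exp (- (Re s * ln (INR n))).
Proof.
  unfold euler_prod. rewrite Cmod_div.
  2:{ intro H. apply (f_equal Cmod) in H.
      rewrite Cmod_mult, Cmod_R, Cmod_Cexp, Cmod_0 in H.
      apply Rmult_integral in H. destruct H as [H|H].
      - apply Rabs_eq_0 in H. revert H. apply INR_fact_neq_0.
      - pose proof (exp_pos (Re (s * RtoC (ln (INR n)))%C)). lra. }
  rewrite Cmod_mult, Cmod_R, Cmod_Cexp, Rabs_pos_eq by apply pos_INR.
  rewrite re_scal_r, exp_Ropp. field. split; [|apply INR_fact_neq_0].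
  pose proof (exp_pos (Re s * ln (INR n))). lra.
Qed.

(** All m + 1 factors of the numerator are at most 2m in modulus, so the quotient
    by m! is at most 2m (2m)^m / m! <= 2m 2^m e^m. *)
Lemma euler_prod_start (s : C) (m : nat) :
  (1 <= m)%nat -> 2 * Cmod s <= INR m ->
  Cmod (euler_prod s m) <= exp (4 * INR m - Re s * ln (INR m)).
Proof.
  intros Hm Hs. assert (Hm1 : 1 <= INR m) by (apply (le_INR 1); lia).
  rewrite Cmod_euler_prod. unfold Rminus. rewrite exp_plus.
  apply Rmult_le_compat_r; [apply Rlt_le, exp_pos|].
  pose proof (INR_fact_lt_0 m) as Hf.
  apply Rmult_le_reg_r with (INR (fact m)); [assumption|].
  unfold Rdiv. rewrite Rmult_assoc, Rinv_l, Rmult_1_r by lra.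
  eapply Rle_trans.
  { apply (Crising_bound s (2 * INR m)). rewrite S_INR. pose proof (Cmod_ge_0 s). lra. }
  rewrite <- tech_pow_Rmult, Rpow_mult_distr.
  pose proof (pow_le_fact_exp m) as H1.
  assert (H2 : 2 ^ m <= exp (INR m)).
  { rewrite <- (Rmult_1_l (INR m)), Rmult_comm.
    replace (exp (INR m * 1)) with (exp 1 ^ m)
      by (rewrite <- Rpower_pow by apply exp_pos; unfold Rpower; now rewrite ln_exp).
    apply pow_incr. pose proof (exp_ineq1_le 1). lra. }
  pose proof (exp_ineq1_le (2 * INR m)) as H3.
  replace (4 * INR m) with (2 * INR m + (INR m + INR m)) by ring.
  rewrite !exp_plus.
  pose proof (exp_pos (INR m)).
  rewrite !Rmult_assoc.
  rewrite <- Rmult_assoc.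
  apply Rmult_le_compat; [lra| apply Rmult_le_pos; apply pow_le; lra | lra |].
  apply Rmult_le_compat; [apply pow_le; lra| apply pow_le; lra | assumption | lra].
Qed.

Lemma euler_prod_bound (s : C) (m n : nat) :
  (1 <= m <= n)%nat -> 2 * Cmod s <= INR m ->
  Cmod (euler_prod s n) <= exp (16 * INR m - Re s * ln (INR m)).
Proof.
  intros Hm Hs.
  eapply Rle_trans; [apply euler_prod_growth; eassumption|].
  replace (16 * INR m - Re s * ln (INR m)) with
    ((4 * INR m - Re s * ln (INR m)) + 12 * INR m) by ring.
  rewrite exp_plus.
  apply Rmult_le_compat; [apply Cmod_ge_0|apply Rlt_le, exp_pos| |].
  - apply euler_prod_start; [lia|assumption].
  - apply exp_le.
    assert (0 < INR m) by (apply lt_0_INR; lia).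
    assert (0 < / INR n) by (apply Rinv_0_lt_compat, lt_0_INR; lia).
    replace (12 * INR m) with (12 * INR m ^ 2 * / INR m) by (field; lra).
    apply Rmult_le_compat_l; [nra|lra].
Qed.

(** * Limits of complex sequences *)

Definition is_C_lim_seq (u : nat -> C) (l : C) : Prop :=
  is_lim_seq (fun n => Re (u n)) (Re l) /\ is_lim_seq (fun n => Im (u n)) (Im l).

Lemma C_Lim_seq_unique (u : nat -> C) (l : C) :
  is_C_lim_seq u l -> C_Lim_seq u = l.
Proof.
  intros [H1 H2]. unfold C_Lim_seq.
  rewrite (is_lim_seq_unique _ _ H1), (is_lim_seq_unique _ _ H2).
  now destruct l.
Qed.

Lemma is_C_lim_seq_mult (u v : nat -> C) (l m : C) :
  is_C_lim_seq u l -> is_C_lim_seq v m ->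
  is_C_lim_seq (fun n => (u n * v n)%C) (l * m)%C.
Proof.
  intros [H1 H2] [H3 H4]; split; simpl.
  - apply is_lim_seq_minus'; apply is_lim_seq_mult'; assumption.
  - apply is_lim_seq_plus'; apply is_lim_seq_mult'; assumption.
Qed.

Lemma is_C_lim_seq_RtoC (u : nat -> R) (l : R) :
  is_lim_seq u l -> is_C_lim_seq (fun n => RtoC (u n)) (RtoC l).
Proof. intros H; split; simpl; [assumption | apply is_lim_seq_const]. Qed.

Lemma is_C_lim_seq_const (c : C) : is_C_lim_seq (fun _ => c) c.
Proof. split; apply is_lim_seq_const. Qed.

Lemma is_C_lim_seq_Cmod_le (u : nat -> C) (l : C) (B : R) (N : nat) :
  (forall n, (N <= n)%nat -> Cmod (u n) <= B) -> is_C_lim_seq u l -> Cmod l <= B.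
Proof.
  intros HB [H1 H2].
  assert (HB0 : 0 <= B) by (eapply Rle_trans; [apply Cmod_ge_0 | apply (HB N); lia]).
  apply Rsqr_incr_0_var; [|assumption].
  unfold Rsqr. replace (Cmod l * Cmod l) with (Cmod l ^ 2) by ring.
  rewrite Cmod2_alt.
  change (Rbar_le (Finite (Re l ^ 2 + Im l ^ 2)) (Finite (B * B))).
  apply (is_lim_seq_le_loc (fun n => Re (u n) ^ 2 + Im (u n) ^ 2) (fun _ => B * B)).
  - exists N. intros n Hn. rewrite <- Cmod2_alt. simpl. rewrite Rmult_1_r.
    apply Rmult_le_compat; auto using Cmod_ge_0.
  - simpl. apply is_lim_seq_plus'; apply is_lim_seq_mult'; try assumption;
      apply is_lim_seq_mult'; try assumption; apply is_lim_seq_const.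
  - apply is_lim_seq_const.
Qed.

Lemma is_lim_seq_inv_INR : is_lim_seq (fun n => / INR n) 0.
Proof.
  change (Finite 0) with (Rbar_inv p_infty).
  apply is_lim_seq_inv; [apply is_lim_seq_INR | discriminate].
Qed.

(** Steps summing to at most D/n beyond index n make the sequence Cauchy. *)
Lemma ex_lim_seq_telescoping (u : nat -> R) (D : R) (N : nat) :
  (1 <= N)%nat ->
  (forall n, (N <= n)%nat -> Rabs (u (S n) - u n) <= D * (/ INR n - / INR (S n))) ->
  ex_finite_lim_seq u.
Proof.
  intros HN Hstep. apply ex_lim_seq_cauchy_corr.
  assert (H : forall n p, (N <= n <= p)%nat ->
    Rabs (u p - u n) <= D * (/ INR n - / INR p)).
  { intros n p [Hn Hp]. induction Hp as [|p Hp IH].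
    - rewrite !Rminus_diag, Rabs_R0. lra.
    - replace (u (S p) - u n) with ((u (S p) - u p) + (u p - u n)) by ring.
      eapply Rle_trans; [apply Rabs_triang|].
      specialize (Hstep p ltac:(lia)). lra. }
  intros eps.
  assert (HD : is_lim_seq (fun n => Rabs D * / INR n) (Rabs D * 0))
    by (apply is_lim_seq_mult'; [apply is_lim_seq_const | apply is_lim_seq_inv_INR]).
  rewrite Rmult_0_r in HD. apply is_lim_seq_spec in HD.
  destruct (HD eps) as [M HM].
  assert (H' : forall n p, (M + N <= n <= p)%nat -> Rabs (u p - u n) < eps).
  { intros n p Hnp. specialize (H n p ltac:(lia)). specialize (HM n ltac:(lia)).
    rewrite Rminus_0_r, Rabs_mult, Rabs_Rabsolu in HM.
    assert (0 < / INR n) by (apply Rinv_0_lt_compat, lt_0_INR; lia).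
    assert (0 < / INR p) by (apply Rinv_0_lt_compat, lt_0_INR; lia).
    assert (/ INR p <= / INR n)
      by (apply Rinv_le_contravar; [apply lt_0_INR; lia | apply le_INR; lia]).
    rewrite (Rabs_pos_eq (/ INR n)) in HM by lra.
    pose proof (Rle_abs D). pose proof (Rabs_pos D). nra. }
  exists (M + N)%nat. intros n p Hn Hp.
  destruct (Nat.le_ge_cases n p).
  - rewrite Rabs_minus_sym. apply H'; lia.
  - apply H'; lia.
Qed.

(** * The reciprocal Gamma function *)

Lemma exists_INR_ge (x : R) : exists m : nat, (1 <= m)%nat /\ x <= INR m.
Proof.
  destruct (INR_archimed 1 x ltac:(lra)) as [m Hm].
  exists (S m). split; [lia|]. rewrite S_INR. lra.
Qed.

(** The products are bounded and their factors are 1 + O(1/n^2), so the steps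
    satisfy the telescoping bound.  This is what makes [rGamma s] a genuine limit. *)
Lemma is_lim_euler_prod (s : C) : is_C_lim_seq (euler_prod s) (rGamma s).
Proof.
  destruct (exists_INR_ge (2 * Cmod s)) as [m [Hm Hs]].
  set (B := exp (16 * INR m - Re s * ln (INR m))).
  assert (Hstep : forall n, (m <= n)%nat ->
    Cmod (euler_prod s (S n) - euler_prod s n)%C <=
      B * (12 * INR m ^ 2) * (/ INR n - / INR (S n))).
  { intros n Hn. rewrite euler_prod_S by lia.
    set (F := ((1 + _) * _)%C).
    replace (euler_prod s n * F - euler_prod s n)%C
      with (euler_prod s n * (F - 1))%C by ring.
    rewrite Cmod_mult, Rmult_assoc.
    apply Rmult_le_compat; try apply Cmod_ge_0.
    - apply euler_prod_bound; [lia | assumption].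
    - apply euler_factor_bound; [lia | assumption]. }
  assert (H1 : ex_finite_lim_seq (fun n => Re (euler_prod s n))).
  { apply (ex_lim_seq_telescoping _ (B * (12 * INR m ^ 2)) m Hm). intros n Hn.
    eapply Rle_trans; [|apply Hstep, Hn]. apply (re_le_Cmod (_ - _)%C). }
  assert (H2 : ex_finite_lim_seq (fun n => Im (euler_prod s n))).
  { apply (ex_lim_seq_telescoping _ (B * (12 * INR m ^ 2)) m Hm). intros n Hn.
    eapply Rle_trans; [|apply Hstep, Hn]. apply (im_le_Cmod (_ - _)%C). }
  destruct H1 as [x Hx], H2 as [y Hy].
  assert (H : is_C_lim_seq (euler_prod s) (x, y)) by (split; assumption).
  replace (rGamma s) with (x, y); [assumption|].
  symmetry. exact (C_Lim_seq_unique _ _ H).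
Qed.

(** The parameter m is left free because the decay of the coefficients uses a
    sequence of m that is affine in k rather than close to |s|. *)
Lemma rGamma_bound (s : C) (m : nat) :
  (1 <= m)%nat -> 2 * Cmod s <= INR m ->
  Cmod (rGamma s) <= exp (16 * INR m - Re s * ln (INR m)).
Proof.
  intros Hm Hs. apply (is_C_lim_seq_Cmod_le (euler_prod s) _ _ m).
  - intros n Hn. apply euler_prod_bound; [lia | assumption].
  - apply is_lim_euler_prod.
Qed.

Lemma Crising_shift (s : C) (n : nat) :
  (Crising s (S n) = s * Crising (s + 1) n)%C.
Proof.
  induction n as [|n IH]; [simpl; ring|].
  change (Crising s (S (S n))) with (Crising s (S n) * (s + RtoC (INR (S n))))%C.
  rewrite IH, S_INR, RtoC_plus. simpl. ring.
Qed.

Lemma euler_prod_shift (s : C) (n : nat) : (1 <= n)%nat ->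
  (s * euler_prod (s + 1) n = euler_prod s n * (1 + (s + 1) * RtoC (/ INR n)))%C.
Proof.
  intros Hn. unfold euler_prod.
  assert (Hn0 : 0 < INR n) by (apply lt_0_INR; lia).
  assert (E : Cexp ((s + 1) * RtoC (ln (INR n)))%C =
    (Cexp (s * RtoC (ln (INR n))) * RtoC (INR n))%C).
  { replace (RtoC (INR n)) with (Cexp (RtoC (ln (INR n))))
      by (rewrite Cexp_RtoC, exp_ln; trivial).
    rewrite <- Cexp_plus. f_equal. ring. }
  rewrite E.
  pose proof (Crising_shift s (S n)) as Hc.
  change (Crising s (S (S n))) with (Crising s (S n) * (s + RtoC (INR (S n))))%C in Hc.
  rewrite S_INR, RtoC_plus in Hc.
  unfold Cdiv. rewrite Cmult_assoc, <- Hc, RtoC_inv by lra.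
  pose proof (Cexp_neq_0 (s * RtoC (ln (INR n)))%C).
  assert (RtoC (INR (fact n)) <> 0%C)
    by (intro H'; apply RtoC_inj in H'; revert H'; apply INR_fact_neq_0).
  assert (RtoC (INR n) <> 0%C) by (intro H'; apply RtoC_inj in H'; lra).
  field. repeat split; assumption.
Qed.

Lemma is_C_lim_seq_ext_loc (u v : nat -> C) (l : C) :
  (forall n, (1 <= n)%nat -> u n = v n) -> is_C_lim_seq u l -> is_C_lim_seq v l.
Proof.
  intros E [H1 H2]; split; eapply is_lim_seq_ext_loc; try eassumption;
    exists 1%nat; intros n Hn; now rewrite E.
Qed.

(** The n-th products for s and s + 1 satisfy the equation up to the factor
    1 + (s + 1)/n, which tends to 1. *)
Lemma rGamma_shift (s : C) : (s * rGamma (s + 1) = rGamma s)%C.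
Proof.
  pose proof (is_C_lim_seq_mult _ _ _ _ (is_C_lim_seq_const s) (is_lim_euler_prod (s + 1)%C)) as H1.
  assert (H0 : is_C_lim_seq (fun n => 1 + (s + 1) * RtoC (/ INR n))%C 1%C).
  { pose proof (is_C_lim_seq_mult _ _ _ _ (is_C_lim_seq_const (s + 1)%C)
      (is_C_lim_seq_RtoC _ _ is_lim_seq_inv_INR)) as [A B].
    rewrite Cmult_0_r in A, B.
    split.
    - replace (Re 1%C) with (1 + Re 0%C) by (simpl; ring).
      apply (is_lim_seq_plus' (fun _ => 1)); [apply is_lim_seq_const | exact A].
    - replace (Im 1%C) with (0 + Im 0%C) by (simpl; ring).
      apply (is_lim_seq_plus' (fun _ => 0)); [apply is_lim_seq_const | exact B]. }
  pose proof (is_C_lim_seq_mult _ _ _ _ (is_lim_euler_prod s) H0) as H2.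
  apply (is_C_lim_seq_ext_loc _ _ _ (euler_prod_shift s)) in H1.
  rewrite <- (C_Lim_seq_unique _ _ H1), (C_Lim_seq_unique _ _ H2).
  ring.
Qed.

(** * Absolutely convergent complex series *)

Definition C_abs_conv (u : nat -> C) : Prop := ex_series (fun k => Cmod (u k)).

Lemma ex_series_Rabs_le (u w : nat -> R) :
  (forall k, Rabs (u k) <= w k) -> ex_series w -> ex_series u.
Proof. exact (ex_series_le (V := R_CompleteNormedModule) u w). Qed.

Lemma C_abs_conv_le (u : nat -> C) (w : nat -> R) :
  (forall k, Cmod (u k) <= w k) -> ex_series w -> C_abs_conv u.
Proof.
  intros H Hw. apply (ex_series_Rabs_le _ w); [|assumption].
  intros k.
  rewrite Rabs_pos_eq by apply Cmod_ge_0. apply H.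
Qed.

Lemma C_abs_conv_Re (u : nat -> C) :
  C_abs_conv u -> ex_series (fun k => Rabs (Re (u k))).
Proof.
  apply ex_series_Rabs_le. intros k. rewrite Rabs_Rabsolu. apply re_le_Cmod.
Qed.

Lemma C_abs_conv_Im (u : nat -> C) :
  C_abs_conv u -> ex_series (fun k => Rabs (Im (u k))).
Proof.
  apply ex_series_Rabs_le. intros k. rewrite Rabs_Rabsolu. apply im_le_Cmod.
Qed.

Lemma C_abs_conv_plus (u v : nat -> C) :
  C_abs_conv u -> C_abs_conv v -> C_abs_conv (fun k => u k + v k)%C.
Proof.
  intros Hu Hv. apply C_abs_conv_le with (fun k => Cmod (u k) + Cmod (v k)).
  - intros k. apply Cmod_triangle.
  - apply (ex_series_plus (K := R_AbsRing) (V := R_NormedModule)); assumption.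
Qed.

Lemma C_abs_conv_scal (c : C) (u : nat -> C) :
  C_abs_conv u -> C_abs_conv (fun k => c * u k)%C.
Proof.
  intros Hu. apply C_abs_conv_le with (fun k => Cmod c * Cmod (u k)).
  - intros k. rewrite Cmod_mult. apply Rle_refl.
  - apply (ex_series_scal_l (K := R_AbsRing) (V := R_NormedModule)). exact Hu.
Qed.

Lemma C_Series_ext (u v : nat -> C) :
  (forall k, u k = v k) -> C_Series u = C_Series v.
Proof.
  intros H. unfold C_Series. f_equal; apply Series_ext; intros k; now rewrite H.
Qed.

Lemma C_Series_plus (u v : nat -> C) : C_abs_conv u -> C_abs_conv v ->
  C_Series (fun k => u k + v k)%C = (C_Series u + C_Series v)%C.
Proof.
  intros Hu Hv. apply injective_projections; simpl; apply Series_plus;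
    apply ex_series_Rabs;
    (apply C_abs_conv_Re || apply C_abs_conv_Im); assumption.
Qed.

Lemma C_Series_scal (c : C) (u : nat -> C) : C_abs_conv u ->
  C_Series (fun k => c * u k)%C = (c * C_Series u)%C.
Proof.
  intros Hu.
  pose proof (ex_series_Rabs _ (C_abs_conv_Re u Hu)) as HR.
  pose proof (ex_series_Rabs _ (C_abs_conv_Im u Hu)) as HI.
  apply injective_projections; simpl; rewrite <- !Series_scal_l;
    [apply Series_minus | apply Series_plus];
    apply (ex_series_scal_l (K := R_AbsRing) (V := R_NormedModule)); assumption.
Qed.

(** The factor 2 comes from bounding the real and imaginary parts separately. *)
Lemma C_Series_Cmod_le (u : nat -> C) : C_abs_conv u ->
  Cmod (C_Series u) <= 2 * Series (fun k => Cmod (u k)).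
Proof.
  intros Hu. eapply Rle_trans; [apply Cmod_le_Re_Im|].
  replace (2 * Series (fun k => Cmod (u k))) with
    (Series (fun k => Cmod (u k)) + Series (fun k => Cmod (u k))) by ring.
  apply Rplus_le_compat; simpl.
  - eapply Rle_trans; [apply Series_Rabs, C_abs_conv_Re, Hu|].
    apply Series_le; [|exact Hu]. intros k. split; [apply Rabs_pos | apply re_le_Cmod].
  - eapply Rle_trans; [apply Series_Rabs, C_abs_conv_Im, Hu|].
    apply Series_le; [|exact Hu]. intros k. split; [apply Rabs_pos | apply im_le_Cmod].
Qed.

(** * Entire power series *)

(** Decay faster than every geometric sequence, that is, infinite radius of
    convergence. *)
Definition entire_coeffs (c : nat -> C) : Prop :=
  forall r : R, 0 <= r -> exists N : nat, forall k, (N <= k)%nat -> Cmod (c k) * r ^ k <= 1.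

(** One summable sequence that dominates, on |z| <= r with r >= 1, the terms of
    the power series, of its formal derivative and,
    up to the factor |h|^2, of the second-order remainder. *)
Definition majorant (c : nat -> C) (r : R) (k : nat) : R :=
  INR (S k) ^ 2 * r ^ k * Cmod (c k).

(** Decay at ratio 8 r absorbs (k + 1)^2 <= 4^k and leaves (1/2)^k. *)
Lemma majorant_summable (c : nat -> C) (r : R) :
  entire_coeffs c -> 0 <= r -> ex_series (majorant c r).
Proof.
  intros Hc Hr. destruct (Hc (8 * r) ltac:(lra)) as [N HN].
  apply (ex_series_incr_n _ N).
  apply (ex_series_Rabs_le _ (fun k => (1/2) ^ k)).
  2: { apply ex_series_geom. rewrite Rabs_pos_eq; lra. }
  intros k.
  specialize (HN (N + k)%nat ltac:(lia)).
  assert (H2 : forall j, INR (S j) <= 2 ^ j).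
  { induction j as [|j IH]; [simpl; lra|].
    rewrite <- tech_pow_Rmult, S_INR. pose proof (pos_INR j).
    rewrite S_INR in *. lra. }
  assert (H3 : (1/2) ^ (N + k) <= (1/2) ^ k).
  { rewrite pow_add. assert (0 <= (1/2) ^ k) by (apply pow_le; lra).
    assert ((1/2) ^ N <= 1 ^ N) by (apply pow_incr; lra).
    rewrite pow1 in *. nra. }
  eapply Rle_trans; [|exact H3]. clear H3.
  unfold majorant. set (j := (N + k)%nat) in *.
  pose proof (Cmod_ge_0 (c j)).
  assert (0 <= r ^ j) by (apply pow_le; assumption).
  rewrite Rabs_pos_eq.
  2: { apply Rmult_le_pos; [apply Rmult_le_pos; [apply pow2_ge_0|]|]; assumption. }
  assert (H4 : INR (S j) ^ 2 <= 4 ^ j).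
  { replace 4 with (2 * 2) by ring. rewrite Rpow_mult_distr.
    replace (2 ^ j * 2 ^ j) with ((2 ^ j) ^ 2) by ring.
    apply pow_incr. split; [apply pos_INR | apply H2]. }
  apply Rle_trans with (4 ^ j * r ^ j * Cmod (c j)).
  { rewrite !Rmult_assoc. apply Rmult_le_compat_r; [|assumption].
    apply Rmult_le_pos; assumption. }
  replace (4 ^ j * r ^ j * Cmod (c j)) with ((1/2) ^ j * (Cmod (c j) * (8 * r) ^ j)).
  2: { rewrite Rpow_mult_distr. replace (4 ^ j) with ((1/2) ^ j * 8 ^ j); [ring|].
       rewrite <- Rpow_mult_distr. f_equal; field. }
  assert (0 <= (1/2) ^ j) by (apply pow_le; lra). nra.
Qed.

(** The remainder D_k satisfies D_{k+1} = (z + h) D_k + k h^2 z^{k-1}, and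
    k^2 + k <= (k + 1)^2 carries the induction. *)
Lemma Cpow_taylor2 (z h : C) (r : R) (k : nat) :
  1 <= r -> Cmod z + Cmod h <= r ->
  Cmod ((z + h) ^ k - z ^ k - h * (RtoC (INR k) * z ^ pred k))%C
    <= INR k ^ 2 * r ^ k * Cmod h ^ 2.
Proof.
  intros Hr Hzh. pose proof (Cmod_ge_0 z). pose proof (Cmod_ge_0 h).
  induction k as [|k IH].
  - simpl. replace (1 - 1 - h * (0 * 1))%C with (RtoC 0) by ring. rewrite Cmod_0. lra.
  - set (D := ((z + h) ^ k - z ^ k - h * (RtoC (INR k) * z ^ pred k))%C) in *.
    replace ((z + h) ^ S k - z ^ S k - h * (RtoC (INR (S k)) * z ^ pred (S k)))%C
      with ((z + h) * D + RtoC (INR k) * (h * h) * z ^ pred k)%C.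
    2: { unfold D. rewrite S_INR, RtoC_plus. destruct k as [|k]; simpl; ring. }
    eapply Rle_trans; [apply Cmod_triangle|].
    rewrite !Cmod_mult, Cmod_pow, Cmod_R, Rabs_pos_eq by apply pos_INR.
    assert (Hz1 : Cmod z ^ pred k <= r ^ S k).
    { apply Rle_trans with (r ^ pred k); [apply pow_incr; lra|].
      apply Rle_pow; [assumption | lia]. }
    assert (Hz2 : Cmod (z + h)%C * Cmod D <= r * (INR k ^ 2 * r ^ k * Cmod h ^ 2)).
    { apply Rmult_le_compat; try apply Cmod_ge_0; [|assumption].
      eapply Rle_trans; [apply Cmod_triangle | assumption]. }
    pose proof (pos_INR k).
    assert (Hz3 : INR k * (Cmod h * Cmod h) * Cmod z ^ pred k
       <= INR k * (Cmod h * Cmod h) * r ^ S k) by (apply Rmult_le_compat_l; [|assumption];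
       apply Rmult_le_pos; [assumption | apply Rmult_le_pos; assumption]).
    assert (0 <= r ^ S k * Cmod h ^ 2)
      by (apply Rmult_le_pos; [apply pow_le; lra | apply pow2_ge_0]).
    set (P := r ^ S k * Cmod h ^ 2) in *.
    replace (r * (INR k ^ 2 * r ^ k * Cmod h ^ 2)) with (INR k ^ 2 * P) in Hz2
      by (unfold P; simpl; ring).
    replace (INR k * (Cmod h * Cmod h) * r ^ S k) with (INR k * P) in Hz3
      by (unfold P; ring).
    rewrite (Rmult_assoc (INR (S k) ^ 2)). fold P. rewrite S_INR. nra.
Qed.

Definition C_PSeries (c : nat -> C) (z : C) : C := C_Series (fun k => z ^ k * c k)%C.

Definition C_PSeries_deriv (c : nat -> C) (z : C) : C :=
  C_Series (fun k => RtoC (INR k) * z ^ pred k * c k)%C.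

Lemma C_PSeries_abs_conv (c : nat -> C) (z : C) :
  entire_coeffs c -> C_abs_conv (fun k => z ^ k * c k)%C.
Proof.
  intros Hc. apply C_abs_conv_le with (majorant c (1 + Cmod z)).
  2: { apply majorant_summable; [assumption|]. pose proof (Cmod_ge_0 z); lra. }
  intros k. rewrite Cmod_mult, Cmod_pow. unfold majorant.
  apply Rmult_le_compat_r; [apply Cmod_ge_0|].
  pose proof (Cmod_ge_0 z).
  apply Rle_trans with (1 * (1 + Cmod z) ^ k).
  - rewrite Rmult_1_l. apply pow_incr. lra.
  - apply Rmult_le_compat_r; [apply pow_le; lra|].
    rewrite S_INR. pose proof (pos_INR k). nra.
Qed.

Lemma C_PSeries_deriv_abs_conv (c : nat -> C) (z : C) :
  entire_coeffs c -> C_abs_conv (fun k => RtoC (INR k) * z ^ pred k * c k)%C.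
Proof.
  intros Hc. apply C_abs_conv_le with (majorant c (1 + Cmod z)).
  2: { apply majorant_summable; [assumption|]. pose proof (Cmod_ge_0 z); lra. }
  intros k. rewrite !Cmod_mult, Cmod_pow, Cmod_R, Rabs_pos_eq by apply pos_INR.
  unfold majorant. pose proof (Cmod_ge_0 z). pose proof (pos_INR k).
  apply Rmult_le_compat_r; [apply Cmod_ge_0|].
  apply Rmult_le_compat; [assumption | apply pow_le; assumption | |].
  - rewrite S_INR. nra.
  - apply Rle_trans with ((1 + Cmod z) ^ pred k); [apply pow_incr; lra|].
    apply Rle_pow; [lra | lia].
Qed.

(** Sum the bounds of [Cpow_taylor2] over k, with r = 1 + |z| so that every
    |h| <= 1 is covered by the same majorant. *)
Lemma C_PSeries_taylor2 (c : nat -> C) (z : C) : entire_coeffs c ->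
  exists M, 0 <= M /\ forall h, Cmod h <= 1 ->
    Cmod (C_PSeries c (z + h) - C_PSeries c z - h * C_PSeries_deriv c z)%C
      <= M * Cmod h ^ 2.
Proof.
  intros Hc. set (r := 1 + Cmod z).
  assert (Hr : 1 <= r) by (unfold r; pose proof (Cmod_ge_0 z); lra).
  assert (Hmaj := majorant_summable c r Hc ltac:(lra)).
  exists (2 * Rabs (Series (majorant c r))).
  split; [pose proof (Rabs_pos (Series (majorant c r))); lra|].
  intros h Hh.
  assert (A1 := C_PSeries_abs_conv c (z + h)%C Hc).
  assert (A2 := C_PSeries_abs_conv c z Hc).
  assert (A3 := C_PSeries_deriv_abs_conv c z Hc).
  set (d := fun k => (((z + h) ^ k - z ^ k - h * (RtoC (INR k) * z ^ pred k)) * c k)%C).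
  assert (E : (C_PSeries c (z + h) - C_PSeries c z - h * C_PSeries_deriv c z)%C = C_Series d).
  { unfold C_PSeries, C_PSeries_deriv.
    rewrite (C_Series_ext d (fun k => ((z + h) ^ k * c k +
      ((- (1)) * (z ^ k * c k) + (- h) * (RtoC (INR k) * z ^ pred k * c k))))%C)
      by (intros k; unfold d; ring).
    rewrite !C_Series_plus, !C_Series_scal
      by auto using C_abs_conv_plus, C_abs_conv_scal. ring. }
  rewrite E.
  assert (Hd : forall k, Cmod (d k) <= Cmod h ^ 2 * majorant c r k).
  { intros k. unfold d, majorant. rewrite Cmod_mult.
    replace (Cmod h ^ 2 * (INR (S k) ^ 2 * r ^ k * Cmod (c k)))
      with (INR (S k) ^ 2 * r ^ k * Cmod h ^ 2 * Cmod (c k)) by ring.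
    apply Rmult_le_compat_r; [apply Cmod_ge_0|].
    eapply Rle_trans; [apply (Cpow_taylor2 z h r); [assumption | unfold r; lra]|].
    apply Rmult_le_compat_r; [apply pow2_ge_0|].
    apply Rmult_le_compat_r; [apply pow_le; lra|].
    apply pow_incr. rewrite S_INR. pose proof (pos_INR k). lra. }
  assert (Hmaj2 : ex_series (fun k => Cmod h ^ 2 * majorant c r k))
    by (apply (ex_series_scal_l (K := R_AbsRing) (V := R_NormedModule)); assumption).
  eapply Rle_trans; [apply C_Series_Cmod_le, (C_abs_conv_le _ _ Hd Hmaj2)|].
  rewrite (Rmult_assoc 2). apply Rmult_le_compat_l; [lra|].
  apply Rle_trans with (Cmod h ^ 2 * Series (majorant c r)).
  - rewrite <- Series_scal_l. apply Series_le; [|assumption].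
    intros k. split; [apply Cmod_ge_0 | apply Hd].
  - rewrite Rmult_comm. apply Rmult_le_compat_r; [apply pow2_ge_0 | apply Rle_abs].
Qed.

Lemma is_derive_C_PSeries (c : nat -> C) (z : C) : entire_coeffs c ->
  @is_derive C_AbsRing C_NormedModule (C_PSeries c) z (C_PSeries_deriv c z).
Proof.
  intros Hc. destruct (C_PSeries_taylor2 c z Hc) as [M [HM HT]].
  split; [apply is_linear_scal_l|].
  intros x Hx.
  apply (is_filter_lim_locally_unique (V := AbsRing_NormedModule C_AbsRing)) in Hx. subst x.
  intros eps.
  assert (Hd : 0 < Rmin 1 (eps / (M + 1))).
  { apply Rmin_pos; [lra|]. apply Rdiv_lt_0_compat; [apply cond_pos | lra]. }
  exists (mkposreal _ Hd). intros y Hy. change C in (type of y).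
  change (Cmod (y - z)%C < Rmin 1 (eps / (M + 1))) in Hy.
  change (Cmod (C_PSeries c y - C_PSeries c z - (y - z) * C_PSeries_deriv c z)%C
    <= eps * Cmod (y - z)%C).
  specialize (HT (y - z)%C).
  replace (z + (y - z))%C with y in HT by ring.
  pose proof (Rmin_l 1 (eps / (M + 1))). pose proof (Rmin_r 1 (eps / (M + 1))).
  eapply Rle_trans; [apply HT; lra|].
  pose proof (Cmod_ge_0 (y - z)%C).
  assert (Cmod (y - z)%C * (M + 1) <= eps).
  { apply Rle_trans with (eps / (M + 1) * (M + 1)).
    - apply Rmult_le_compat_r; lra.
    - right. field. lra. }
  nra.
Qed.

(** * Coefficients of the Mittag-Leffler function *)

(** Apply [rGamma_bound] with m = M (k + 1), where M >= 2 (|a| + |b|).  For k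
    large Re (b + a k) >= k Re a / 2, and then the exponent
    16 M (k + 1) + r k - Re (b + a k) ln m is nonpositive once ln m exceeds
    the constant T = 2 (32 M + r) / Re a. *)
Lemma entire_coeffs_rGamma (a b : C) : 0 < Re a ->
  entire_coeffs (fun k => rGamma (b + a * RtoC (INR k))%C).
Proof.
  intros Ha r Hr.
  destruct (exists_INR_ge (2 * (Cmod a + Cmod b))) as [M [HM HMab]].
  set (T := 2 * (32 * INR M + r) / Re a).
  destruct (exists_INR_ge (exp T + 2 * Rabs (Re b) / Re a)) as [N [HN HNb]].
  (* The first summand bounding N makes ln m >= T, the second makes
     |Re b| <= k Re a / 2. *)
  exists N. intros k Hk.
  assert (HkN : INR N <= INR k) by (apply le_INR; assumption).
  assert (Hk1 : 1 <= INR k) by (apply (le_INR 1); lia).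
  assert (HM1 : 1 <= INR M) by (apply (le_INR 1); lia).
  pose proof (Cmod_ge_0 a) as Ha0. pose proof (Cmod_ge_0 b) as Hb0.
  set (s := (b + a * RtoC (INR k))%C).
  assert (Hs : 2 * Cmod s <= INR (M * S k)).
  { rewrite mult_INR, S_INR.
    assert (Cmod s <= Cmod b + Cmod a * INR k).
    { unfold s. eapply Rle_trans; [apply Cmod_triangle|].
      rewrite Cmod_mult, Cmod_R, Rabs_pos_eq; lra. }
    nra. }
  pose proof (rGamma_bound s (M * S k) ltac:(nia) Hs) as HG.
  assert (HRe : Re s = Re b + Re a * INR k).
  { unfold s. rewrite <- re_scal_r. reflexivity. }
  assert (Hpos : 0 <= 2 * Rabs (Re b) / Re a).
  { apply Rmult_le_pos; [pose proof (Rabs_pos (Re b)); lra|].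
    apply Rlt_le, Rinv_0_lt_compat, Ha. }
  assert (HL : T <= ln (INR (M * S k))).
  { rewrite <- (ln_exp T). apply ln_le; [apply exp_pos|].
    rewrite mult_INR, S_INR. nra. }
  assert (HT0 : 0 <= T).
  { unfold T. apply Rmult_le_pos; [lra|]. apply Rlt_le, Rinv_0_lt_compat, Ha. }
  assert (HRe2 : Re a * INR k / 2 <= Re s).
  { assert (Hb : 2 * Rabs (Re b) / Re a <= INR k) by (pose proof (exp_pos T); lra).
    apply (Rmult_le_compat_r (Re a)) in Hb; [|lra].
    replace (2 * Rabs (Re b) / Re a * Re a) with (2 * Rabs (Re b)) in Hb by (field; lra).
    pose proof (Rcomplements.Rabs_maj2 (Re b)). rewrite HRe. lra. }
  assert (HTk : (32 * INR M + r) * INR k <= Re s * ln (INR (M * S k))).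
  { apply Rle_trans with (Re a * INR k / 2 * T).
    - right. unfold T. field. lra.
    - apply Rmult_le_compat; try assumption.
      apply Rmult_le_pos; [apply Rmult_le_pos|]; lra. }
  assert (Hrk : r ^ k <= exp (r * INR k)).
  { rewrite Rmult_comm.
    replace (exp (INR k * r)) with (exp r ^ k)
      by (rewrite <- Rpower_pow by apply exp_pos; unfold Rpower; now rewrite ln_exp).
    apply pow_incr. pose proof (exp_ineq1_le r). lra. }
  apply Rle_trans with
    (exp (16 * INR (M * S k) - Re s * ln (INR (M * S k))) * exp (r * INR k)).
  { apply Rmult_le_compat; try assumption; [apply Cmod_ge_0 | apply pow_le; assumption]. }
  rewrite <- exp_plus, <- exp_0. apply exp_le.
  rewrite mult_INR at 1. rewrite S_INR. nra.
Qed.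

Open Scope C_scope.

(* [C_derive] alone only takes the difference quotient along the real
   direction; together with [ex_derive] over C it is the complex derivative
   ([C_derive_correct]). *)
Theorem mainTheorem2 :
  forall a b : C, (0 < Re a)%R ->
  forall z : C,
    @ex_derive C_AbsRing C_NormedModule (MittagLeffler a b) z /\
    a * z * C_derive (MittagLeffler a b) z =
      MittagLeffler a (b - 1) z - (b - 1) * MittagLeffler a b z.
Proof.
  intros a b Ha z.
  set (c := fun k => rGamma (b + a * RtoC (INR k))).
  assert (Hc : entire_coeffs c) by exact (entire_coeffs_rGamma a b Ha).
  pose proof (is_derive_C_PSeries c z Hc) as HD.
  split; [exists (C_PSeries_deriv c z); exact HD|].
  rewrite (is_C_derive_unique (MittagLeffler a b) z _ HD).
  pose proof (C_PSeries_abs_conv c z Hc) as A1.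
  pose proof (C_PSeries_deriv_abs_conv c z Hc) as A2.
  assert (E : MittagLeffler a (b - 1) z =
    a * z * C_PSeries_deriv c z + (b - 1) * MittagLeffler a b z).
  { unfold MittagLeffler, C_PSeries_deriv. fold c.
    change (C_Series (fun k => z ^ k * rGamma (b + a * RtoC (INR k))))
      with (C_Series (fun k => z ^ k * c k)).
    rewrite <- !C_Series_scal by assumption.
    rewrite <- C_Series_plus by auto using C_abs_conv_scal.
    apply C_Series_ext. intros k.
    rewrite <- rGamma_shift.
    replace (b - 1 + a * RtoC (INR k) + 1) with (b + a * RtoC (INR k)) by ring.
    fold (c k).
    (* At k = 0 both sides of a k z^k = a z (k z^{k-1}) vanish, whatever z^{pred 0}. *)
    destruct k as [|k]; simpl; ring. }
  rewrite E. ring.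
Qed.
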